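(* Let $f=\{f_n:\{0,1\}^n\to\{0,1\}^n\}_{n\in\mathbb{N}}$ be an $s(n)$-secure quantum one-way function family, and let $W_n\subseteq\{0,1\}^n$. Consider quantum registers $K$ (of arbitrary size), $O$ ($n$ qubits) and $C$ ($n$ qubits). Let $\mathcal{D}_{n,0}$ be a quantum circuit with $|\tilde\psi_{n,0}\rangle=\mathcal{D}_{n,0}|\mathbf{0}\rangle$ a state on $K\otimes O\otimes C$, and let $\mathcal{U}_n$ be a unitary circuit acting only on $K\otimes O$, with $|\tilde\psi_{n,1}\rangle=\mathcal{U}_n|\tilde\psi_{n,0}\rangle$. Define the projections $$\mathcal{P}_0=\sum_{x\in W_n}|x\rangle\langle x|_O\otimes |f_n(x)\rangle_{+}\langle f_n(x)|_C,\qquad \mathcal{P}_1=\sum_{x\in W_n}|x\rangle\langle x|_O\otimes |f_n(x)\rangle_{\times}\langle f_n(x)|_C,$$ and $b_0(n)=\|\mathcal{P}_0|\tilde\psi_{n,0}\rangle\|^2$, $b_1(n)=\|\mathcal{P}_1|\tilde\psi_{n,1}\rangle\|^2$ (the probabilities that this adversary against the Base Protocol successfully reveals $0$, resp. $1$, with a decommitment $x\in W_n$). If $b_0(n)+b_1(n)\ge 1+1/\sqrt{s(n)}$, then there exists a quantum algorithm $\mathcal{A}$, consisting of one application of $\mathcal{D}_{n,0}$, one application of $\mathcal{U}_n$ and a polynomial-size (in $n$) circuit including an evaluation of $f_n$, such that when $y''$ is drawn from the distribution of $f_n(U_n)$ conditioned on $f_n(U_n)\in f_n(W_n)$, $\mathcal{A}$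 on input $y''$ outputs some $x''\in W_n$ with $f_n(x'')=y''$ with probability $\Omega(1/s(n))$.
   Context: $U_n$ is the uniform distribution on $\{0,1\}^n$. A function family $f=\{f_n:\{0,1\}^n\to\{0,1\}^n\}$ is $s(n)$-secure quantum one-way if (i) there is a polynomial-size quantum circuit family computing $f_n(x)$ with certainty from $|x\rangle|\mathbf{0}\rangle$, and (ii) for every polynomial-size quantum circuit family $\{\mathcal{B}_n\}$ and all sufficiently large $n$, $\Pr[f_n(\mathcal{B}_n(f_n(U_n)))=f_n(U_n)]<1/s(n)$. Notation: $|b\rangle_+=|b\rangle$ is the computational basis, $|0\rangle_\times=(|0\rangle+|1\rangle)/\sqrt2$, $|1\rangle_\times=(|0\rangle-|1\rangle)/\sqrt2$, and for $z=z_1\cdots z_n$, $|z\rangle_\theta=\bigotimes_i|z_i\rangle_\theta$. The Base Protocol: to commit to $w\in\{0,1\}$ Alice picks uniform $x$ and sends $|f_n(x)\rangle_{\theta(w)}$ with $\theta(0)=+$, $\theta(1)=\times$; to reveal she announces $w,x$ and Bob measures in basis $\theta(w)$ and accepts iff the outcome is $f_n(x)$. *)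

(* Defs.v *)
(* Finite-dimensional quantum computation over an abstract
   numClosedFieldType C (e.g. algC, or complex numbers). *)
From HB Require Import structures.
From mathcomp Require Import all_boot all_order all_algebra.
Set Implicit Arguments. Unset Strict Implicit. Unset Printing Implicit Defensive.
Import Order.TTheory GRing.Theory Num.Theory.
Local Open Scope ring_scope.

(* computational-basis labels of an m-qubit register: {0,1}^m *)
Notation bitstr m := {ffun 'I_m -> bool}.

Definition zeros (m : nat) : bitstr m := [ffun => false].
(* splitting / joining a register (m + r qubits) into its first m and last r qubits *)
Definition lpart (m r : nat) (a : bitstr (m + r)) : bitstr m := [ffun i => a (lshift r i)].
Definition rpart (m r : nat) (a : bitstr (m + r)) : bitstr r := [ffun i => a (rshift m i)].
Definition join (m r : nat) (x : bitstr m) (y : bitstr r) : bitstr (m + r) :=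
  [ffun i => match split i with inl j => x j | inr j => y j end].

Section Quantum.
Variable C : numClosedFieldType.

(* states (vectors) and operators (matrices, given by their kernels) on m qubits *)
Definition state (m : nat) := bitstr m -> C.
Definition op (m : nat) := bitstr m -> bitstr m -> C.

Definition app m (M : op m) (v : state m) : state m := fun a => \sum_b M a b * v b.
Definition mulop m (A B : op m) : op m := fun a c => \sum_b A a b * B b c.
Definition idop m : op m := fun a b => (a == b)%:R.
Definition adjop m (M : op m) : op m := fun a b => (M b a)^*.
Definition unitary m (M : op m) : Prop := forall a b, mulop (adjop M) M a b = idop a b.
(* computational basis vector |a> *)
Definition ket m (a : bitstr m) : state m := fun b => (b == a)%:R.
(* squared Euclidean norm *)
Definition norm2 m (v : state m) : C := \sum_a `|v a| ^+ 2.

(* M acting on the first m qubits, identity on the last r qubits: M (x) I *)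
Definition embl m r (M : op m) : op (m + r) :=
  fun a b => M (lpart a) (lpart b) * (rpart a == rpart b)%:R.

(* ---------- circuits over the gate set {H, T, CNOT, Toffoli} ---------- *)
Inductive gate (N : nat) : Type :=
| GH of 'I_N                       (* Hadamard *)
| GT of 'I_N                       (* pi/8 phase gate *)
| GCNOT of 'I_N & 'I_N             (* control, target *)
| GTOF of 'I_N & 'I_N & 'I_N.      (* control, control, target *)

(* <x| H |y> *)
Definition h_entry (x y : bool) : C := (if x && y then -1 else 1) / sqrtC 2.
(* <x| T |y> *)
Definition t_entry (x y : bool) : C :=
  if x != y then 0 else if x then (1 + 'i) / sqrtC 2 else 1.

(* the qubits outside Q are unchanged *)
Definition others N (Q : seq 'I_N) (a b : bitstr N) : bool :=
  [forall j, (j \notin Q) ==> (a j == b j)].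

Definition gate_op N (g : gate N) : op N := fun a b =>
  match g with
  | GH i => h_entry (a i) (b i) * (others [:: i] a b)%:R
  | GT i => t_entry (a i) (b i) * (others [:: i] a b)%:R
  | GCNOT i j => [&& a i == b i, a j == (b j (+) b i) & others [:: i; j] a b]%:R
  | GTOF i j l =>
      [&& a i == b i, a j == b j, a l == (b l (+) (b i && b j)) & others [:: i; j; l] a b]%:R
  end.

Definition gate_ok N (g : gate N) : bool :=
  match g with
  | GH _ | GT _ => true
  | GCNOT i j => i != j
  | GTOF i j l => uniq [:: i; j; l]
  end.

Definition circuit_ok N (G : seq (gate N)) : bool := all (@gate_ok N) G.

(* operator of a circuit; gates are applied in list order *)
Definition circ_op N (G : seq (gate N)) : op N :=
  foldr (fun g M => mulop M (gate_op g)) (@idop N) G.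

(* ---------- standard input/output layout: In (n) | Out (n) | Anc (a) ---------- *)
Definition io_init n a (x : bitstr n) : bitstr (n + (n + a)) := join x (zeros (n + a)).

(* probability that circuit G on input |x>|0>|0> yields z when Out is measured *)
Definition run_prob n a (G : seq (gate (n + (n + a)))) (x z : bitstr n) : C :=
  \sum_(c : bitstr (n + (n + a)) | lpart (rpart c) == z) `|circ_op G c (io_init a x)| ^+ 2.

Definition poly_bounded (p : nat -> nat) : Prop :=
  exists c d : nat, forall n, (p n <= c * n ^ d + c)%N.

(* (i): a polynomial-size quantum circuit family computes f_n with certainty *)
Definition qcomputable (f : forall n, bitstr n -> bitstr n) : Prop :=
  exists p, poly_bounded p /\
    forall n, exists (a : nat) (G : seq (gate (n + (n + a)))),
      circuit_ok G /\ (size G <= p n)%N /\ forall x, run_prob G x (f n x) = 1.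

(* Pr[ f_n(B_n(f_n(U_n))) = f_n(U_n) ] *)
Definition invert_prob (f : forall n, bitstr n -> bitstr n) n a
    (B : seq (gate (n + (n + a)))) : C :=
  \sum_(x : bitstr n) ((2 : C) ^+ n)^-1 *
     \sum_(z : bitstr n | f n z == f n x) run_prob B (f n x) z.

(* s(n)-secure quantum one-way function family *)
Definition qowf (f : forall n, bitstr n -> bitstr n) (s : nat -> C) : Prop :=
  qcomputable f /\
  forall (a : nat -> nat) (B : forall n, seq (gate (n + (n + a n)))),
    (forall n, circuit_ok (B n)) -> poly_bounded (fun n => size (B n)) ->
    exists N0, forall n, (N0 <= n)%N -> invert_prob f (B n) < (s n)^-1.

(* ---------- Base Protocol projections on K (k) (x) O (n) (x) C (n) ---------- *)
(* |z>_theta : theta = false is the + basis, theta = true the x basis *)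
Definition basis_ket n (theta : bool) (z : bitstr n) : state n :=
  if theta then (fun c : bitstr n => \prod_i h_entry (z i) (c i)) else ket z.

(* P_theta = sum_{x in W} I_K (x) |x><x|_O (x) |f x>_theta <f x|_C *)
Definition proj_P k n (f : bitstr n -> bitstr n) (W : {set bitstr n}) (theta : bool)
    : op ((k + n) + n) := fun a b =>
  \sum_(x in W)
    (lpart (lpart a) == lpart (lpart b))%:R *
    ((rpart (lpart a) == x) && (rpart (lpart b) == x))%:R *
    (basis_ket theta (f x) (rpart a) * (basis_ket theta (f x) (rpart b))^*).

(* ---------- the inverting algorithm A ----------
   registers: K (k) | O (n) | C (n) | In (n) | Anc (a);
   A = G3 . X2 . G2 . X1 . G1 with {X1, X2} = {D (x) I, U (x) I} (in either order),
   input y'' loaded in In, output = measurement of O. *)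
Definition alg_op k n a (D : op ((k + n) + n)) (U : op (k + n))
    (G1 G2 G3 : seq (gate (((k + n) + n) + (n + a)))) (order : bool)
    : op (((k + n) + n) + (n + a)) :=
  let Dm := embl (r:=n + a) D in
  let Um := embl (r:=n + a) (embl (r:=n) U) in
  let X1 := if order then Um else Dm in
  let X2 := if order then Dm else Um in
  mulop (circ_op G3) (mulop X2 (mulop (circ_op G2) (mulop X1 (circ_op G1)))).

Definition alg_init k n a (y : bitstr n) : bitstr (((k + n) + n) + (n + a)) :=
  join (zeros ((k + n) + n)) (join y (zeros a)).

Definition alg_prob k n a (A : op (((k + n) + n) + (n + a))) (y z : bitstr n) : C :=
  \sum_(c : bitstr (((k + n) + n) + (n + a)) | rpart (lpart (lpart c)) == z)
    `|A c (alg_init k a y)| ^+ 2.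

(* Pr[A(y'') outputs x'' in W with f x'' = y''], y'' ~ f(U_n) | f(U_n) in f(W) *)
Definition alg_success k n a (f : bitstr n -> bitstr n) (W : {set bitstr n})
    (A : op (((k + n) + n) + (n + a))) : C :=
  (\sum_(x : bitstr n | f x \in f @: W)
      \sum_(z in W | f z == f x) alg_prob A (f x) z)
  / #|[set x : bitstr n | f x \in f @: W]|%:R.

End Quantum.

(* Main.v *)
(* Apply D, multiply by (-1)^(y.c) (c the value of the commitment register C), XOR f(x)
   into C (x the value of O), apply U and measure O.  On the part phi of D|0> with
   c = f(x), register C ends up in |0>, with the rest in the state
   2^(n/2) <y|_times U phi, since U does not act on C.  As 2^n is at least the number
   of preimages of f(W), the success probability is at least |P_1 U phi|^2; no test for
   membership in W is needed.  The other part chi = D|0> - phi has |chi|^2 <= 1 - b_0, so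
   b_1 <= (1 + 2/eps) |P_1 U phi|^2 + (1 + eps/2) (1 - b_0) with eps = s^(-1/2),
   and b_0 + b_1 >= 1 + eps forces |P_1 U phi|^2 >= eps^2 / 6. *)
Require Import Defs.
From HB Require Import structures.
From mathcomp Require Import all_boot all_order all_algebra.
From mathcomp Require Import ring zify.
From Stdlib Require Import FunctionalExtensionality.
Set Implicit Arguments. Unset Strict Implicit. Unset Printing Implicit Defensive.
Import Order.TTheory GRing.Theory Num.Theory.
Local Open Scope ring_scope.

(** * Registers and gates *)

Lemma join_lpart m r (x : bitstr m) (y : bitstr r) : lpart (join x y) = x.
Proof. by apply/ffunP=> i; rewrite !ffunE (unsplitK (inl i)). Qed.

Lemma join_rpart m r (x : bitstr m) (y : bitstr r) : rpart (join x y) = y.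
Proof. by apply/ffunP=> i; rewrite !ffunE (unsplitK (inr i)). Qed.

Lemma join_lshift m r (x : bitstr m) (y : bitstr r) i : join x y (lshift r i) = x i.
Proof. by rewrite ffunE (unsplitK (inl i)). Qed.

Lemma join_rshift m r (x : bitstr m) (y : bitstr r) i : join x y (rshift m i) = y i.
Proof. by rewrite ffunE (unsplitK (inr i)). Qed.

Lemma join_parts m r (a : bitstr (m + r)) : join (lpart a) (rpart a) = a.
Proof.
apply/ffunP=> i; rewrite ffunE.
by case: splitP => j ij; rewrite ffunE; congr (a _); apply: val_inj.
Qed.

Lemma eq_bitstrD m r (a b : bitstr (m + r)) :
  (a == b) = (lpart a == lpart b) && (rpart a == rpart b).
Proof.
apply/eqP/andP=> [->|[/eqP l /eqP q]]; first by split.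
by rewrite -(join_parts a) l q join_parts.
Qed.

Lemma sum_join (V : nmodType) m r (F : bitstr (m + r) -> V) :
  \sum_a F a = \sum_x \sum_y F (join x y).
Proof.
rewrite pair_big /= (reindex (fun p : bitstr m * bitstr r => join p.1 p.2)) //=.
exists (fun a => (lpart a, rpart a)) => [[x y]|a] _ /=.
  by rewrite join_lpart join_rpart.
exact: join_parts.
Qed.

Lemma sum_delta (R : pzSemiRingType) (I : finType) (i0 : I) (F : I -> R) :
  \sum_i (i == i0)%:R * F i = F i0.
Proof.
rewrite (bigD1 i0) //= eqxx mul1r big1 ?addr0 // => i /negPf->.
by rewrite mul0r.
Qed.

(** * Single-bit updates, and the classical gates as involutions on labels *)

Section Bits.
Variable N : nat.
Implicit Types (a b : bitstr N) (i j l : 'I_N).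

Definition upd a i (x : bool) : bitstr N := [ffun j => if j == i then x else a j].

Lemma upd_id a i : upd a i (a i) = a.
Proof. by apply/ffunP=> j; rewrite ffunE; case: eqP => // ->. Qed.

Lemma upd_upd a i x y : upd (upd a i x) i y = upd a i y.
Proof. by apply/ffunP=> j; rewrite !ffunE; case: eqP. Qed.

Lemma upd_eq a i x : upd a i x i = x.
Proof. by rewrite ffunE eqxx. Qed.

Lemma upd_neq a i x j : j != i -> upd a i x j = a j.
Proof. by rewrite ffunE => /negPf->. Qed.

Lemma othersP (Q : seq 'I_N) a b :
  reflect (forall j, j \notin Q -> a j = b j) (others Q a b).
Proof.
apply: (iffP forallP) => h j; first by move=> nQ; have := h j; rewrite nQ => /eqP.
by apply/implyP=> nQ; rewrite h.
Qed.

(** For a fixed value of [b i] exactly one [b] is left, which collapses the sum over [b] in a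
    one-qubit gate. *)
Lemma others1 i a b : others [:: i] a b = (b == upd a i (b i)).
Proof.
apply/othersP/eqP => [h|-> j]; last by rewrite inE => ?; rewrite upd_neq.
apply/ffunP=> j; rewrite ffunE; case: eqP => [->//|/eqP ne].
by rewrite h // inE.
Qed.

Definition flip a i := upd a i (~~ a i).

Lemma flipK i : involutive (flip^~ i).
Proof. by move=> a; rewrite /flip upd_eq upd_upd negbK upd_id. Qed.

Definition cnot i j a := upd a j (a j (+) a i).
Definition tof i j l a := upd a l (a l (+) (a i && a j)).

Lemma cnotK i j : i != j -> involutive (cnot i j).
Proof.
by move=> ne a; rewrite /cnot upd_upd upd_eq upd_neq // -addbA addbb addbF upd_id.
Qed.

Lemma tofK i j l : uniq [:: i; j; l] -> involutive (tof i j l).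
Proof.
rewrite /= !inE negb_or -!andbA => /and4P[_ il jl _] a.
by rewrite /tof upd_upd upd_eq !upd_neq // -addbA addbb addbF upd_id.
Qed.

End Bits.

(** * Action of circuits on state vectors: composition, inverses, norm preservation *)

Section Circuits.
Variable C : numClosedFieldType.

Lemma sum_join_delta m r (F : bitstr (m + r) -> C) (y : bitstr r) :
  \sum_a F a * (rpart a == y)%:R = \sum_x F (join x y).
Proof.
rewrite sum_join; apply: eq_bigr => x _; rewrite -(sum_delta y (fun z => F (join x z))).
by apply: eq_bigr => z _; rewrite join_rpart mulrC.
Qed.

Lemma app_ket m (M : op C m) b : app M (ket C b) = M^~ b.
Proof.
apply: functional_extensionality => a; rewrite /app /ket.
by under eq_bigr do rewrite mulrC; rewrite sum_delta.
Qed.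

Lemma app_mulop m (A B : op C m) v : app (mulop A B) v = app A (app B v).
Proof.
apply: functional_extensionality => a; rewrite /app /mulop.
under eq_bigr do rewrite mulr_suml; rewrite exchange_big /=.
apply: eq_bigr => b _; rewrite mulr_sumr; apply: eq_bigr => c _; exact/esym/mulrA.
Qed.

Lemma app_idop m (v : state C m) : app (@idop C m) v = v.
Proof.
apply: functional_extensionality => a; rewrite /app /idop -[RHS](sum_delta a v).
by apply: eq_bigr => b _; rewrite eq_sym.
Qed.

Lemma mulop1 m (M : op C m) : mulop M (@idop C m) = M.
Proof.
do 2!apply: functional_extensionality => ?; rewrite /mulop /idop.
by under eq_bigr do rewrite mulrC; rewrite sum_delta.
Qed.

Lemma mul1op m (M : op C m) : mulop (@idop C m) M = M.
Proof.
do 2!apply: functional_extensionality => ?.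
by rewrite -[LHS]/(app (@idop C m) (M^~ _) _) app_idop.
Qed.

Lemma app_scale m (M : op C m) c v :
  app M (fun a => c * v a) = fun a => c * app M v a.
Proof.
apply: functional_extensionality => a; rewrite /app mulr_sumr.
by apply: eq_bigr => b _; rewrite mulrCA.
Qed.

Definition run N (G : seq (gate N)) (v : state C N) : state C N :=
  app (circ_op C G) v.

Lemma run_nil N (v : state C N) : run [::] v = v.
Proof. exact: app_idop. Qed.

Lemma run_cons N g G (v : state C N) : run (g :: G) v = run G (app (gate_op C g) v).
Proof. exact: app_mulop. Qed.

Lemma run_cat N G1 G2 (v : state C N) : run (G1 ++ G2) v = run G2 (run G1 v).
Proof.
by elim: G1 v => [|g G1 IH] v; rewrite ?run_nil // cat_cons !run_cons IH.
Qed.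

Section Gates.
Variable N : nat.
Implicit Types (v : state C N) (a : bitstr N) (i j l : 'I_N).

Lemma app_GH i v :
  app (gate_op C (GH i)) v = fun a => \sum_x h_entry C (a i) x * v (upd a i x).
Proof.
apply: functional_extensionality => a; rewrite /app /=.
rewrite (partition_big (fun b : bitstr N => b i) predT) //=; apply: eq_bigr => x _.
rewrite (bigD1 (upd a i x)) /= ?upd_eq // big1 ?addr0.
  by rewrite others1 upd_eq eqxx mulr1.
by move=> b /andP[/eqP <-]; rewrite others1 => /negPf->; rewrite mulr0 mul0r.
Qed.

Lemma app_GT i v : app (gate_op C (GT i)) v = fun a => t_entry C (a i) (a i) * v a.
Proof.
apply: functional_extensionality => a; rewrite /app /= (bigD1 a) //= big1 ?addr0.
  by rewrite others1 upd_id eqxx mulr1.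
move=> b ne; rewrite others1 /t_entry; case: eqP => [e|]; last by rewrite !mul0r.
by rewrite -e upd_id (negPf ne) mulr0 mul0r.
Qed.

(** Row [a] has its only nonzero entry in column [p a], so the amplitudes are pulled back along [p].
    CNOT and Toffoli are involutions, hence [p] is the gate itself and not a separate inverse. *)
Lemma app_perm (M : op C N) (p : bitstr N -> bitstr N) :
  (forall a b, M a b = (b == p a)%:R) -> forall v, app M v = v \o p.
Proof.
move=> h v; apply: functional_extensionality => a; rewrite /app.
by under eq_bigr do rewrite h; rewrite sum_delta.
Qed.

Lemma app_CNOT i j v : i != j -> app (gate_op C (GCNOT i j)) v = v \o cnot i j.
Proof.
move=> ij; apply: app_perm => a b /=; congr (_%:R); congr nat_of_bool.
apply/and3P/eqP => [[/eqP ei /eqP ej /othersP h]|->].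
  apply/ffunP=> k; rewrite ffunE; case: (eqVneq k j) => [->|kj].
    by rewrite ej ei -addbA addbb addbF.
  by case: (eqVneq k i) => [->//|ki]; rewrite h // !inE negb_or ki kj.
rewrite /cnot upd_eq upd_neq // -addbA addbb addbF; split=> //.
by apply/othersP=> k; rewrite !inE negb_or => /andP[_ ?]; rewrite upd_neq.
Qed.

Lemma app_TOF i j l v : uniq [:: i; j; l] ->
  app (gate_op C (GTOF i j l)) v = v \o tof i j l.
Proof.
rewrite /= !inE negb_or -!andbA => /and4P[_ il jl _].
apply: app_perm => a b /=; congr (_%:R); congr nat_of_bool.
apply/and4P/eqP => [[/eqP ei /eqP ej /eqP el /othersP h]|->].
  apply/ffunP=> k; rewrite ffunE; case: (eqVneq k l) => [->|kl].
    by rewrite el ei ej -addbA addbb addbF.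
  case: (eqVneq k i) => [->//|ki]; case: (eqVneq k j) => [->//|kj].
  by rewrite h // !inE !negb_or ki kj kl.
rewrite /tof upd_eq !upd_neq // -addbA addbb addbF; split=> //.
by apply/othersP=> k; rewrite !inE !negb_or => /and3P[_ _ ?]; rewrite upd_neq.
Qed.

End Gates.

Lemma sqrtC2_sqr : (sqrtC 2 : C) ^+ 2 = 2. Proof. exact: sqrtCK. Qed.

Definition t_phase : C := t_entry C true true.

Lemma t_phase2 : t_phase ^+ 2 = 'i.
Proof.
rewrite /t_phase /t_entry /= expr_div_n sqrtC2_sqr sqrrD sqrCi expr1n mul1r.
by rewrite addrAC subrr add0r -mulr_natl mulrAC divff ?mul1r // pnatr_eq0.
Qed.

Lemma t_phase4 : t_phase ^+ 4 = -1.
Proof. by rewrite (exprM t_phase 2 2) t_phase2 sqrCi. Qed.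

Lemma t_phase8 : t_phase ^+ 8 = 1.
Proof. by rewrite (exprM t_phase 4 2) t_phase4 sqrrN expr1n. Qed.

Lemma t_phase_norm : `|t_phase| = 1.
Proof.
apply/eqP; rewrite -(pexpr_eq1 (n := 8)) // -?normrX ?t_phase8 ?normr1 //.
Qed.

Lemma run_nseqT N k i (v : state C N) :
  run (nseq k (GT i)) v = fun a => (if a i then t_phase else 1) ^+ k * v a.
Proof.
elim: k v => [|k IH] v /=.
  by rewrite run_nil; apply: functional_extensionality => a; rewrite expr0 mul1r.
rewrite run_cons IH app_GT; apply: functional_extensionality => a.
by rewrite exprSr -mulrA; case: (a i).
Qed.

Lemma h_entry_sqr (x y z : bool) :
  h_entry C x true * h_entry C true z + h_entry C x false * h_entry C false z
  = (x == z)%:R.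
Proof.
have h : (sqrtC 2 : C)^-1 * (sqrtC 2)^-1 = 2^-1.
  by rewrite -invfM -expr2 sqrtC2_sqr.
case: x z => [] [] /=; rewrite /h_entry /= ?mulN1r ?mul1r ?mulrNN ?mulrN ?mulNr h ?subrr ?addNr //;
 by rewrite -[2^-1]mul1r -splitr.
Qed.

Lemma GHK N i (v : state C N) : app (gate_op C (GH i)) (app (gate_op C (GH i)) v) = v.
Proof.
rewrite !app_GH; apply: functional_extensionality => a.
rewrite !big_bool /= !upd_eq !upd_upd.
rewrite -[in RHS](upd_id a i).
transitivity ((a i == true)%:R * v (upd a i true) + (a i == false)%:R * v (upd a i false)).
  by rewrite -(h_entry_sqr _ true) -(h_entry_sqr _ false); ring.
by case: (a i); rewrite mul1r mul0r ?addr0 ?add0r.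
Qed.

(** H, CNOT and Toffoli invert themselves; T has order 8, so its inverse is spelled as seven T
    gates. This is the source of the factor 7 in [size_circ_inv]. *)
Definition gate_inv N (g : gate N) : seq (gate N) :=
  if g is GT i then nseq 7 (GT i) else [:: g].

Definition circ_inv N (G : seq (gate N)) : seq (gate N) :=
  flatten (rev (map (@gate_inv N) G)).

Lemma gate_invK N (g : gate N) v : gate_ok g ->
  run (gate_inv g) (app (gate_op C g) v) = v.
Proof.
case: g => [i|i|i j|i j l] ok.
- by rewrite run_cons run_nil GHK.
- rewrite -run_cons -[_ :: _]/(nseq 8 (GT i)) run_nseqT.
  by apply: functional_extensionality => a; case: (a i); rewrite ?t_phase8 ?expr1n mul1r.
- rewrite run_cons run_nil !app_CNOT //.
  by apply: functional_extensionality => a /=; rewrite cnotK.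
- rewrite run_cons run_nil !app_TOF //.
  by apply: functional_extensionality => a /=; rewrite tofK.
Qed.

Lemma circ_invK N (G : seq (gate N)) v : circuit_ok G -> run (circ_inv G) (run G v) = v.
Proof.
elim: G v => [|g G IH] v /=; first by rewrite !run_nil.
move=> /andP[gok Gok]; rewrite /circ_inv /= rev_cons flatten_rcons run_cat run_cons.
by rewrite -/(circ_inv G) IH // gate_invK.
Qed.

Lemma size_circ_inv N (G : seq (gate N)) : (size (circ_inv G) <= 7 * size G)%N.
Proof.
elim: G => //= g G IH; rewrite /circ_inv /= rev_cons flatten_rcons size_cat mulnS addnC.
by apply: leq_add => //; case: g.
Qed.

Lemma circ_inv_ok N (G : seq (gate N)) : circuit_ok G -> circuit_ok (circ_inv G).
Proof.
elim: G => //= g G IH /andP[gok Gok].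
rewrite /circ_inv /= rev_cons flatten_rcons /circuit_ok all_cat.
apply/andP; split; first exact: IH.
by case: g gok => [i|i|i j|i j l] /=; rewrite ?andbT.
Qed.

Lemma parallelogram (x y : C) :
  `|x + y| ^+ 2 + `|x - y| ^+ 2 = 2 * (`|x| ^+ 2 + `|y| ^+ 2).
Proof. rewrite !normCK !rmorphD !rmorphN /=; ring. Qed.

(** For H, each label is paired with its flip at [i] and the parallelogram law is applied to the two
    amplitudes. T multiplies each amplitude by a number of modulus 1; CNOT and Toffoli permute the
    labels. *)
Lemma norm2_gate N (g : gate N) v : gate_ok g -> norm2 (app (gate_op C g) v) = norm2 v.
Proof.
case: g => [i|i|i j|i j l] ok; rewrite /norm2.
- rewrite app_GH.
  have dbl (F : bitstr N -> C) : 2 * \sum_a F a = \sum_a (F a + F (flip a i)).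
    rewrite big_split /= mulr_natl mulr2n; congr (_ + _).
    exact/(reindex_inj (inv_inj (@flipK N i))).
  apply: (@mulfI _ 2); first by rewrite pnatr_eq0.
  rewrite !dbl; apply: eq_bigr => a _.
  rewrite !big_bool /= /flip !upd_upd upd_eq.
  have nrm (z : C) : `|z / sqrtC 2| ^+ 2 = `|z| ^+ 2 / 2.
    by rewrite normrM exprMn -[X in _ * X]normrX exprVn sqrtC2_sqr normfV normr_nat.
  have P (x y : C) : `|x / sqrtC 2 + y / sqrtC 2| ^+ 2
      + `|x / sqrtC 2 - y / sqrtC 2| ^+ 2 = `|x| ^+ 2 + `|y| ^+ 2.
    rewrite -mulrDl -mulrBl !nrm -mulrDl parallelogram mulrAC divff ?mul1r //.
    by rewrite pnatr_eq0.
  rewrite -[in v a](upd_id a i).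
  case: (a i); rewrite /h_entry /= !mulN1r !mul1r !mulNr ![(sqrtC 2)^-1 * _]mulrC.
    by rewrite [RHS]addrC -[RHS]P [RHS]addrC; congr (_ + _); rewrite addrC.
  by rewrite -[RHS]P; congr (_ + _); rewrite addrC.
- rewrite app_GT; apply: eq_bigr => a _; rewrite normrM /t_entry eqxx /=.
  case: (a i); rewrite ?normr1 ?mul1r //.
  by have := t_phase_norm; rewrite /t_phase /t_entry /= => ->; rewrite mul1r.
- by rewrite app_CNOT // [RHS](reindex_inj (inv_inj (cnotK ok))).
- by rewrite app_TOF // [RHS](reindex_inj (inv_inj (tofK ok))).
Qed.

Lemma norm2_run N (G : seq (gate N)) v : circuit_ok G -> norm2 (run G v) = norm2 v.
Proof.
elim: G v => [|g G IH] v /=; first by rewrite run_nil.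
by move=> /andP[gok Gok]; rewrite run_cons IH // norm2_gate.
Qed.

Lemma norm2_ket m (a : bitstr m) : norm2 (ket C a) = 1.
Proof.
rewrite /norm2 -[RHS](sum_delta a (fun=> 1)); apply: eq_bigr => b _.
by rewrite /ket mulr1; case: eqP; rewrite ?normr1 ?expr1n ?normr0 ?expr0n.
Qed.

End Circuits.

(** * Circuits on a subset of the wires *)

Section Lift.
Variables (C : numClosedFieldType) (M N : nat) (iota : 'I_M -> 'I_N).
Hypothesis iota_inj : injective iota.

Definition map_gate (g : gate M) : gate N :=
  match g with
  | GH i => GH (iota i)
  | GT i => GT (iota i)
  | GCNOT i j => GCNOT (iota i) (iota j)
  | GTOF i j l => GTOF (iota i) (iota j) (iota l)
  end.

Definition pull (a : bitstr N) : bitstr M := [ffun t => a (iota t)].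

(* The state v on the wires iota, tensored with the basis state e on the other wires. *)
Definition lift_state (v : state C M) (e : bitstr N) : state C N :=
  fun a => v (pull a) * (others (codom iota) a e)%:R.

Lemma pull_upd a t x : pull (upd a (iota t) x) = upd (pull a) t x.
Proof. by apply/ffunP=> j; rewrite !ffunE (inj_eq iota_inj). Qed.

Lemma others_upd_codom a t x e :
  others (codom iota) (upd a (iota t) x) e = others (codom iota) a e.
Proof.
apply/othersP/othersP=> h j nj; rewrite -h // upd_neq //;
  by apply: contraNneq nj => ->; apply: codom_f.
Qed.

Lemma map_gate_ok g : gate_ok g -> gate_ok (map_gate g).
Proof.
case: g => [i|i|i j|i j l] //=; first by rewrite (inj_eq iota_inj).
by rewrite !inE !(inj_eq iota_inj).
Qed.

Lemma map_circuit_ok G : circuit_ok G -> circuit_ok (map map_gate G).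
Proof. by rewrite /circuit_ok all_map; apply: sub_all => g; apply: map_gate_ok. Qed.

Lemma app_map_gate g v e : gate_ok g ->
  app (gate_op C (map_gate g)) (lift_state v e) = lift_state (app (gate_op C g) v) e.
Proof.
move=> ok; have ok' := map_gate_ok ok.
apply: functional_extensionality => a.
case: g ok ok' => [i|i|i j|i j l] ok ok'.
- rewrite [map_gate _]/= !app_GH /lift_state mulr_suml !ffunE; apply: eq_bigr => x _.
  by rewrite pull_upd others_upd_codom mulrA.
- by rewrite [map_gate _]/= !app_GT /lift_state ffunE mulrA.
- by rewrite [map_gate _]/= app_CNOT // /lift_state app_CNOT //= /cnot pull_upd others_upd_codom !ffunE.
- by rewrite [map_gate _]/= app_TOF // /lift_state app_TOF //= /tof pull_upd others_upd_codom !ffunE.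
Qed.

Lemma run_map_gate G v e : circuit_ok G ->
  run (map map_gate G) (lift_state v e) = lift_state (run G v) e.
Proof.
elim: G v => [|g G IH] v /=; first by rewrite !run_nil.
by move=> /andP[gok Gok]; rewrite !run_cons app_map_gate // IH.
Qed.

(** A basis state factors across any division of the wires, which puts it in the form that
    [run_map_gate] accepts. *)
Lemma ket_lift_state e : ket C e = lift_state (ket C (pull e)) e.
Proof.
apply: functional_extensionality => a; rewrite /lift_state /ket -natrM mulnb; congr (_ _).
congr nat_of_bool; apply/eqP/andP => [->|[/eqP /ffunP p /othersP h]].
  by split=> //; apply/othersP.
apply/ffunP=> j; case: (boolP (j \in codom iota)) => [/codomP[t ->]|/h//].
by have := p t; rewrite !ffunE.
Qed.

End Lift.

(** * Bitwise CNOT and CZ between two registers *)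

Section Registers.
Variables (C : numClosedFieldType) (n N : nat) (s t : 'I_n -> 'I_N).
Hypothesis st : forall i j, s i != t j.
Hypothesis t_inj : injective t.

Definition cnots (l : seq 'I_n) : seq (gate N) := [seq GCNOT (s i) (t i) | i <- l].

Definition xors (l : seq 'I_n) (a : bitstr N) : bitstr N :=
  foldr (fun i b => cnot (s i) (t i) b) a l.

Lemma cnots_ok l : circuit_ok (cnots l).
Proof. by rewrite /circuit_ok all_map; apply/allP=> i _ /=. Qed.

Lemma run_cnots l (v : state C N) : run (cnots l) v = v \o xors l.
Proof.
elim: l v => [|i l IH] v; first by rewrite run_nil.
by rewrite /= run_cons app_CNOT // IH.
Qed.

Lemma xors_out l a j : j \notin map t l -> xors l a j = a j.
Proof.
elim: l => //= i l IH; rewrite inE negb_or => /andP[ne nj].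
by rewrite /cnot upd_neq // IH.
Qed.

(** No source is a target, so [a (s i)] still has its initial value when it is added, and [uniq l]
    makes this happen only once. *)
Lemma xors_in l a i : uniq l -> i \in l -> xors l a (t i) = a (t i) (+) a (s i).
Proof.
elim: l => //= i0 l IH /andP[ni ul]; rewrite inE /cnot.
case: (eqVneq i i0) => [-> _|ne /= il].
  rewrite upd_eq !xors_out ?mem_map //.
  by apply/mapP => -[j _ /eqP]; apply/negP.
by rewrite upd_neq ?IH // (inj_eq t_inj).
Qed.

(* CZ is the phase polynomial (-1)^(xy) = i^x i^y (-i)^(x XOR y). *)
Definition cz (i j : 'I_N) : seq (gate N) :=
  nseq 2 (GT j) ++ nseq 2 (GT i) ++ GCNOT i j :: nseq 6 (GT j) ++ [:: GCNOT i j].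

Lemma run_cz i j (v : state C N) : i != j ->
  run (cz i j) v = fun a => (-1) ^+ (a i && a j) * v a.
Proof.
move=> ij; apply: functional_extensionality => a.
rewrite /cz !run_cat !run_nseqT run_cons run_cat run_nseqT run_cons run_nil !app_CNOT //=.
rewrite /cnot !upd_upd !upd_eq !upd_neq // -addbA addbb addbF upd_id !mulrA.
congr (_ * _).
(* The total power of [t_phase] is 0, 8, 8 or 4 for the bit pairs 00, 01, 10 and 11. *)
have := t_phase4 C; have := t_phase8 C.
by case: (a i) (a j) => [] [] /= t8 t4; rewrite ?expr1n ?mulr1 ?mul1r // ?expr1 ?expr0 -?t4 -?t8; ring.
Qed.

Definition czs (l : seq 'I_n) : seq (gate N) := flatten [seq cz (s i) (t i) | i <- l].

Lemma czs_ok l : circuit_ok (czs l).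
Proof.
elim: l => //= i l IH; rewrite /czs /= /circuit_ok /= -/(circuit_ok _) !st /=.
exact: IH.
Qed.

Lemma size_czs l : size (czs l) = (12 * size l)%N.
Proof. by elim: l => //= i l IH; rewrite /czs /= -/(czs l) IH mulnS. Qed.

Lemma run_czs l (v : state C N) :
  run (czs l) v = fun a => \prod_(i <- l) (-1) ^+ (a (s i) && a (t i)) * v a.
Proof.
elim: l v => [|i l IH] v.
  by rewrite run_nil; apply: functional_extensionality => a; rewrite big_nil mul1r.
rewrite -[czs _]/(cz (s i) (t i) ++ czs l) run_cat IH run_cz //.
by apply: functional_extensionality => a; rewrite big_cons mulrA [X in X * _]mulrC.
Qed.

End Registers.

(** * Clean evaluation of a function by computing, copying and uncomputing *)

Section Oracle.
Variables (C : numClosedFieldType) (n af N : nat).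
Variables (iota : 'I_(n + (n + af)) -> 'I_N) (t : 'I_n -> 'I_N).
Hypothesis iota_inj : injective iota.
Hypothesis t_inj : injective t.
Hypothesis t_out : forall i, t i \notin codom iota.
Variable G : seq (gate (n + (n + af))).
Hypothesis G_ok : circuit_ok G.

Let out (i : 'I_n) := iota (rshift n (lshift af i)).

Definition oracle : seq (gate N) :=
  map (map_gate iota) G ++ cnots out t (enum 'I_n) ++ map (map_gate iota) (circ_inv G).

Lemma out_t i j : out i != t j.
Proof. by apply: contraNneq (t_out j) => <-; apply: codom_f. Qed.

Lemma oracle_ok : circuit_ok oracle.
Proof.
rewrite /oracle /circuit_ok !all_cat; apply/and3P; split.
- exact: map_circuit_ok.
- by apply: cnots_ok => *; apply: out_t.
- by apply: map_circuit_ok => //; apply: circ_inv_ok.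
Qed.

Lemma size_oracle : (size oracle <= 8 * size G + n)%N.
Proof.
rewrite !size_cat (size_map (fun i => GCNOT (out i) (t i))) size_enum_ord !(size_map (map_gate iota)).
by have := size_circ_inv G; lia.
Qed.

(** The circuit preserves the norm, so all outcome probabilities sum to 1. Those with Out = [y]
    already do, and the remaining nonnegative terms must vanish. *)
Lemma run_prob1_support x y (c : bitstr (n + (n + af))) :
  run_prob C G x y = 1 -> run G (ket C (io_init af x)) c != 0 -> lpart (rpart c) = y.
Proof.
move=> pr; apply: contraNeq => cy.
have := norm2_run (ket C (io_init af x)) G_ok.
rewrite norm2_ket /norm2 (bigID (fun c => lpart (rpart c) == y)) /=.
have -> : \sum_(c | lpart (rpart c) == y) `|run G (ket C (io_init af x)) c| ^+ 2 = 1.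
  by rewrite -pr; apply: eq_bigr => d _; rewrite /run app_ket.
rewrite -[RHS]addr0 => /addrI /eqP; rewrite psumr_eq0; last by move=> *; rewrite exprn_ge0.
by move=> /allP /(_ c (mem_index_enum _)); rewrite cy /= expf_eq0 /= normr_eq0.
Qed.

(* The garbage left by G is supported on Out = y, so the copy acts on the target as
   XOR with the constant y, which commutes with uncomputing. *)
Lemma run_oracle x y (e e' : bitstr N) : run_prob C G x y = 1 ->
  pull iota e = io_init af x ->
  (forall i, e' (t i) = e (t i) (+) y i) ->
  (forall j, j \notin codom t -> e' j = e j) ->
  run oracle (ket C e) = ket C e'.
Proof.
move=> pr ex et eo.
(* The target wires lie outside the range of [iota], so the copy leaves the wires of [G] as they
   were, and uncomputing restores their initial value. *)
have pe : pull iota e' = pull iota e.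
  apply/ffunP=> j; rewrite !ffunE eo //; apply/codomP=> -[i ji].
  by have := t_out i; rewrite -ji codom_f.
rewrite /oracle !run_cat (ket_lift_state C iota e) run_map_gate // ex.
set g := run G _.
suff -> : run (cnots out t (enum 'I_n)) (lift_state iota g e) = lift_state iota g e'.
  rewrite run_map_gate ?circ_inv_ok // circ_invK // -ex -pe; exact/esym/ket_lift_state.
rewrite run_cnots => [|i j]; last exact: out_t.
apply: functional_extensionality => a; rewrite /lift_state /=.
have xin i : xors out t (enum 'I_n) a (t i) = a (t i) (+) a (out i).
  by rewrite xors_in ?enum_uniq ?mem_enum // => *; apply: out_t.
have xout j : j \notin codom t -> xors out t (enum 'I_n) a j = a j.
  by move=> nj; rewrite xors_out // => *; apply: out_t.
have -> : pull iota (xors out t (enum 'I_n) a) = pull iota a.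
  apply/ffunP=> j; rewrite !ffunE xout //; apply/codomP=> -[i ji].
  by have := t_out i; rewrite -ji codom_f.
have [->|/(run_prob1_support pr) gy] := eqVneq (g (pull iota a)) 0; first by rewrite !mul0r.
have ay i : a (out i) = y i by rewrite -gy !ffunE.
congr (_ * (nat_of_bool _)%:R).
apply/othersP/othersP=> h j nj; have := h j nj.
  case: (boolP (j \in codom t)) => [/codomP[i ->]|jt]; last by rewrite xout // eo.
  by rewrite xin et ay => <-; rewrite -addbA addbb addbF.
case: (boolP (j \in codom t)) => [/codomP[i ->]|jt]; last by rewrite xout // eo.
by rewrite xin et ay => ->; rewrite -addbA addbb addbF.
Qed.

End Oracle.

(** * Norms and projections *)

Section Analysis.
Variable C : numClosedFieldType.

Lemma norm2_ge0 m (v : state C m) : 0 <= norm2 v.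
Proof. by apply: sumr_ge0 => a _; rewrite exprn_ge0. Qed.

Lemma norm2_join m r (v : state C (m + r)) :
  norm2 v = \sum_y norm2 (fun x => v (join x y)).
Proof. by rewrite /norm2 sum_join exchange_big. Qed.

Lemma norm2_unitary m (M : op C m) v : unitary M -> norm2 (app M v) = norm2 v.
Proof.
move=> uM; rewrite /norm2 /app.
transitivity (\sum_b \sum_c (v b)^* * v c * mulop (adjop M) M b c).
  under eq_bigr => a _.
    rewrite normCKC rmorph_sum big_distrlr /=.
    over.
  rewrite exchange_big; apply: eq_bigr => b _; rewrite exchange_big /=.
  apply: eq_bigr => c _; rewrite /mulop /adjop mulr_sumr.
  by apply: eq_bigr => a _; rewrite rmorphM /=; ring.
apply: eq_bigr => b _; rewrite normCKC -(sum_delta b (fun c => (v b)^* * v c)).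
by apply: eq_bigr => c _; rewrite uM /idop eq_sym mulrC.
Qed.

Lemma app_embl m r (M : op C m) (v : state C (m + r)) x y :
  app (embl (r:=r) M) v (join x y) = app M (fun x' => v (join x' y)) x.
Proof.
rewrite /app /embl sum_join; apply: eq_bigr => x' _.
rewrite join_lpart join_rpart -(sum_delta y (fun y' => M x x' * v (join x' y'))).
by apply: eq_bigr => y' _; rewrite join_lpart join_rpart eq_sym; ring.
Qed.

Lemma norm2_embl m r (M : op C m) (v : state C (m + r)) :
  unitary M -> norm2 (app (embl (r:=r) M) v) = norm2 v.
Proof.
move=> uM; rewrite norm2_join [RHS]norm2_join; apply: eq_bigr => y _.
rewrite -[RHS](norm2_unitary _ uM); apply: eq_bigr => x _; by rewrite app_embl.
Qed.

Lemma app_add m (M : op C m) v w : app M (fun a => v a + w a) = fun a => app M v a + app M w a.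
Proof.
apply: functional_extensionality => a; rewrite /app -big_split /=.
by apply: eq_bigr => b _; rewrite mulrDr.
Qed.

Definition overlap n theta (z : bitstr n) (v : state C n) : C :=
  \sum_c (basis_ket C theta z c)^* * v c.

(** Up to normalisation, |z> in the x basis is the phase function (-1)^(z.c), which is what bitwise
    CZ multiplies onto register C. *)
Lemma basis_ket_trueE n (z c : bitstr n) :
  basis_ket C true z c = ((sqrtC 2)^-1) ^+ n * \prod_i (-1) ^+ (z i && c i).
Proof.
rewrite /basis_ket -[in _ ^+ n](card_ord n) -prodr_const -big_split /=.
by apply: eq_bigr => i _; rewrite /h_entry mulrC; case: (_ && _).
Qed.

Lemma norm_invsqrt2X n : `|((sqrtC 2 : C)^-1) ^+ n| ^+ 2 = (2 ^+ n)^-1.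
Proof.
by rewrite -normrX -exprM mulnC exprM exprVn sqrtC2_sqr exprVn normfV normrX normr_nat.
Qed.

Lemma norm_basis_ket_true n (z c : bitstr n) : `|basis_ket C true z c| ^+ 2 = (2 ^+ n)^-1.
Proof.
rewrite basis_ket_trueE normrM normr_prod big1 => [|i _]; last by rewrite normrX normrN1 expr1n.
by rewrite mulr1 norm_invsqrt2X.
Qed.

Lemma norm2_basis_ket n theta (z : bitstr n) : norm2 (basis_ket C theta z) = 1.
Proof.
case: theta; last exact: norm2_ket.
rewrite /norm2; under eq_bigr do rewrite norm_basis_ket_true.
rewrite sumr_const card_ffun card_bool card_ord -[_ *+ _]mulr_natr natrX mulVf //.
by rewrite expf_eq0 pnatr_eq0 andbF.
Qed.

Lemma overlap_false n (z : bitstr n) v : overlap false z v = v z.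
Proof.
rewrite /overlap -[RHS](sum_delta z v); apply: eq_bigr => c _.
by rewrite /= /ket conjC_nat.
Qed.

Lemma overlap_add n theta (z : bitstr n) v w :
  overlap theta z (fun c => v c + w c) = overlap theta z v + overlap theta z w.
Proof. by rewrite /overlap -big_split; apply: eq_bigr => c _; rewrite mulrDr. Qed.

(** Cauchy-Schwarz against the unit vector [e]: the residual [v - s e] has squared norm
    [norm2 v - |s|^2], which is nonnegative. *)
Lemma overlap_le n theta (z : bitstr n) v : `|overlap theta z v| ^+ 2 <= norm2 v.
Proof.
set e := basis_ket C theta z; set s := overlap theta z v.
have e1 : \sum_c e c * (e c)^* = 1.
  by rewrite -(norm2_basis_ket theta z); apply: eq_bigr => c _; rewrite normCK.
have es : \sum_c e c * (v c)^* = s^*.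
  by rewrite rmorph_sum; apply: eq_bigr => c _; rewrite rmorphM /= conjCK.
suff E : norm2 (fun c => v c - s * e c) = norm2 v - `|s| ^+ 2.
  by rewrite -subr_ge0 -E norm2_ge0.
transitivity (norm2 v - s^* * (\sum_c (e c)^* * v c) - s * (\sum_c e c * (v c)^*)
              + s * s^* * (\sum_c e c * (e c)^*)).
  rewrite !mulr_sumr -!sumrN -!big_split /=; apply: eq_bigr => c _.
  by rewrite !normCK rmorphB rmorphM /=; ring.
by rewrite e1 es normCK -/(overlap theta z v) -/s; ring.
Qed.

(** The slack is exactly [t^-1 * |x - t y|^2]. The free weight [t] becomes [eps / 2] in
    [consistent_bound]. *)
Lemma normD_sqr_le (t x y : C) : 0 < t ->
  `|x + y| ^+ 2 <= (1 + t^-1) * `|x| ^+ 2 + (1 + t) * `|y| ^+ 2.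
Proof.
move=> t0; rewrite -subr_ge0.
(* In the partial order of [C], positivity includes being real. *)
have tr : t^* = t by apply/CrealP; apply: gtr0_real.
have -> : (1 + t^-1) * `|x| ^+ 2 + (1 + t) * `|y| ^+ 2 - `|x + y| ^+ 2 = t^-1 * `|x - t * y| ^+ 2.
  by rewrite !normCK !rmorphD rmorphN rmorphM /= tr; field; rewrite gt_eqF.
by rewrite mulr_ge0 ?exprn_ge0 ?invr_ge0 // ltW.
Qed.

(** * The two reveal projections, and the bound on the consistent part *)

Section Projections.
Variables (k n : nat) (f : bitstr n -> bitstr n) (W : {set bitstr n}).

Lemma app_proj theta (w : state C ((k + n) + n)) o c :
  app (proj_P C (k:=k) f W theta) w (join o c) =
  (rpart o \in W)%:R * (basis_ket C theta (f (rpart o)) c *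
     overlap theta (f (rpart o)) (fun c' => w (join o c'))).
Proof.
have E b : proj_P C (k:=k) f W theta (join o c) b =
  (rpart o \in W)%:R * (basis_ket C theta (f (rpart o)) c *
     (basis_ket C theta (f (rpart o)) (rpart b))^*) * (lpart b == o)%:R.
  rewrite /proj_P join_lpart join_rpart.
  have [oW|oW] := boolP (rpart o \in W); last first.
    rewrite !mul0r big1 // => x xW; suff -> : (rpart o == x) = false by rewrite mulr0 mul0r.
    by apply: contraNF oW => /eqP->.
  rewrite (bigD1 (rpart o)) //= big1 ?addr0 => [|x /andP[_ /negPf ne]]; last first.
    by rewrite [rpart o == x]eq_sym ne mulr0 mul0r.
  rewrite eqxx /= (eq_bitstrD (lpart b)) [lpart o == _]eq_sym -natrM mulnb mul1r mulrC.
  by [].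
rewrite /app; under eq_bigr do rewrite E.
rewrite sum_join exchange_big /= /overlap !mulr_sumr; apply: eq_bigr => c' _.
rewrite -(sum_delta o (fun x => (rpart o \in W)%:R * (basis_ket C theta (f (rpart o)) c *
  ((basis_ket C theta (f (rpart o)) c')^* * w (join x c'))))).
by apply: eq_bigr => x _; rewrite join_lpart join_rpart; ring.
Qed.

(** The projection is block diagonal over the value [o] of K and O. Each block has rank one or zero
    on C, so it contributes one squared overlap or nothing. *)
Lemma norm2_proj theta (w : state C ((k + n) + n)) :
  norm2 (app (proj_P C (k:=k) f W theta) w) =
  \sum_(o | rpart o \in W) `|overlap theta (f (rpart o)) (fun c => w (join o c))| ^+ 2.
Proof.
rewrite /norm2 sum_join [RHS]big_mkcond /=; apply: eq_bigr => o _.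
under eq_bigr do rewrite app_proj.
case: (rpart o \in W); last by rewrite big1 // => c _; rewrite mul0r normr0 expr0n.
under eq_bigr do rewrite mul1r normrM exprMn.
by rewrite -mulr_suml -/(norm2 _) norm2_basis_ket mul1r.
Qed.

Lemma norm2_proj_le theta w : norm2 (app (proj_P C (k:=k) f W theta) w) <= norm2 w.
Proof.
rewrite norm2_proj [norm2 w]sum_join [leLHS]big_mkcond; apply: ler_sum => o _ /=.
by case: ifP => _; [apply: overlap_le | apply: norm2_ge0].
Qed.

(** The vector phi of the opening sketch; [inconsistent] is chi. Only registers O and C are
    compared, without reference to [W]. *)
Definition consistent (psi : state C ((k + n) + n)) : state C ((k + n) + n) :=
  fun a => (rpart a == f (rpart (lpart a)))%:R * psi a.
Definition inconsistent (psi : state C ((k + n) + n)) : state C ((k + n) + n) :=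
  fun a => (rpart a != f (rpart (lpart a)))%:R * psi a.

Lemma consistent_add psi : psi = fun a => consistent psi a + inconsistent psi a.
Proof.
apply: functional_extensionality => a; rewrite /consistent /inconsistent -mulrDl.
by case: (_ == _); rewrite /= ?addr0 ?add0r mul1r.
Qed.

Lemma norm2_consistent_add psi : norm2 psi = norm2 (consistent psi) + norm2 (inconsistent psi).
Proof.
rewrite /norm2 -big_split; apply: eq_bigr => a _ /=; rewrite /consistent /inconsistent.
by case: (_ == _); rewrite /= mul1r mul0r normr0 expr0n ?addr0 ?add0r.
Qed.

(** In the + basis the overlap with f(x) is the amplitude at c = f(x), which [consistent] retains.
    For unit [psi] this yields |chi|^2 <= 1 - b_0. *)
Lemma norm2_proj_false_le psi :
  norm2 (app (proj_P C (k:=k) f W false) psi) <= norm2 (consistent psi).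
Proof.
rewrite norm2_proj [leRHS]sum_join [leLHS]big_mkcond; apply: ler_sum => o _ /=.
rewrite (bigD1 (f (rpart o))) //= /consistent join_lpart join_rpart eqxx mul1r overlap_false.
case: ifP => _; last by rewrite addr_ge0 ?sumr_ge0 // => *; rewrite exprn_ge0.
by rewrite lerDl sumr_ge0 // => *; rewrite exprn_ge0.
Qed.

Lemma norm2_projD_le theta t v w : 0 < t ->
  norm2 (app (proj_P C (k:=k) f W theta) (fun a => v a + w a)) <=
  (1 + t^-1) * norm2 (app (proj_P C (k:=k) f W theta) v)
  + (1 + t) * norm2 (app (proj_P C (k:=k) f W theta) w).
Proof.
move=> t0; rewrite !norm2_proj !mulr_sumr -big_split /=; apply: ler_sum => o _.
by rewrite overlap_add; apply: normD_sqr_le.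
Qed.

Lemma consistent_bound (U : op C (k + n)) psi eps :
  unitary U -> norm2 psi = 1 -> 0 < eps ->
  1 + eps <= norm2 (app (proj_P C (k:=k) f W false) psi)
             + norm2 (app (proj_P C (k:=k) f W true) (app (embl (r:=n) U) psi)) ->
  eps ^+ 2 / 6 <=
    norm2 (app (proj_P C (k:=k) f W true) (app (embl (r:=n) U) (consistent psi))).
Proof.
move=> uU psi1 e0; have e2 : 0 < eps / 2 by rewrite divr_gt0 // ltr0n.
have := norm2_proj_false_le psi; have := norm2_consistent_add psi.
have := norm2_proj_le true (app (embl (r:=n) U) psi); rewrite norm2_embl // psi1.
have := norm2_proj_le true (app (embl (r:=n) U) (inconsistent psi)); rewrite norm2_embl //.
have := norm2_projD_le true (app (embl (r:=n) U) (consistent psi))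
  (app (embl (r:=n) U) (inconsistent psi)) e2.
rewrite -app_add -consistent_add.
have := norm2_ge0 (app (proj_P C (k:=k) f W true) (app (embl (r:=n) U) (consistent psi))).
have := norm2_ge0 (app (proj_P C (k:=k) f W false) psi).
have := norm2_ge0 (inconsistent psi).
set a := norm2 (app _ (app _ (consistent psi))); set b := norm2 (app _ (app _ (inconsistent psi))).
set b1 := norm2 (app _ (app _ psi)); set b0 := norm2 (app _ psi).
set p := norm2 (consistent psi); set q := norm2 (inconsistent psi).
move=> q0 b00 a0 yb bq b11 pq b0p le.
have pE : p = 1 - q by rewrite pq addrK.
(* The order is partial, so each inequality is recorded as a nonnegative difference, and the
   conclusions are explicit nonnegative combinations of these. *)
have bq' : 0 <= q - b by rewrite subr_ge0.
have b0p' : 0 <= 1 - q - b0 by rewrite -pE subr_ge0.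
have b11' : 0 <= 1 - b1 by rewrite subr_ge0.
have le' : 0 <= b0 + b1 - (1 + eps) by rewrite subr_ge0.
have yb' : 0 <= (1 + (eps / 2)^-1) * a + (1 + eps / 2) * b - b1 by rewrite subr_ge0.
(* Both b_0 and b_1 are at most 1, which forces [eps <= 1]. Multiplying [h] by [eps] gives
   [(eps + 2) a >= eps^2 / 2], and [eps + 2 <= 3] then yields the constant 6. *)
have eps1 : 0 <= 1 - eps.
  have -> : 1 - eps = (b0 + b1 - (1 + eps)) + (1 - b1) + (1 - q - b0) + q by ring.
  by do 3!apply: addr_ge0 => //.
have h : 0 <= (1 + (eps / 2)^-1) * a - eps / 2.
  have -> : (1 + (eps / 2)^-1) * a - eps / 2 =
    ((1 + (eps / 2)^-1) * a + (1 + eps / 2) * b - b1) + (b0 + b1 - (1 + eps))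
    + (1 + eps / 2) * ((1 - q - b0) + (q - b)) + eps / 2 * b0 by field; rewrite gt_eqF.
  have e20 := ltW e2.
  by apply: addr_ge0; [apply: addr_ge0; [exact: addr_ge0|]|];
    apply: mulr_ge0 => //; apply: addr_ge0.
rewrite -subr_ge0.
have -> : a - eps ^+ 2 / 6 =
  3^-1 * (eps * ((1 + (eps / 2)^-1) * a - eps / 2) + (1 - eps) * a) by field; rewrite gt_eqF.
by apply: mulr_ge0; rewrite ?invr_ge0 ?ler0n //; apply: addr_ge0; apply: mulr_ge0 => //; apply: ltW.
Qed.

End Projections.
End Analysis.

(** * The inverter *)

Section Inverter.
Variables (C : numClosedFieldType) (k n af : nat).
Variables (f : bitstr n -> bitstr n) (G : seq (gate (n + (n + af)))).
Hypothesis G_ok : circuit_ok G.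
Hypothesis G_f : forall x, run_prob C G x (f x) = 1.

Local Notation wires := (((k + n) + n) + (n + (n + af)))%N.

Definition commit_wire (i : 'I_n) : 'I_wires := lshift _ (rshift (k + n) i).
Definition input_wire (i : 'I_n) : 'I_wires := rshift _ (lshift _ i).
(* The circuit for f reads O in place and writes to ancillas. *)
Definition oracle_wire (t : 'I_(n + (n + af))) : 'I_wires :=
  match split t with
  | inl j => lshift _ (lshift n (rshift k j))
  | inr j => rshift _ (rshift n j)
  end.

Lemma oracle_wire_inj : injective oracle_wire.
Proof.
move=> t1 t2; rewrite /oracle_wire.
case: (split_ordP t1) => j1 ->; case: (split_ordP t2) => j2 -> /eqP;
  rewrite ?eq_shift // => /eqP.
  by move=> ->.
by move=> ->.
Qed.

Lemma commit_wire_inj : injective commit_wire.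
Proof. by move=> i j /lshift_inj/rshift_inj. Qed.

Lemma commit_wire_out i : commit_wire i \notin codom oracle_wire.
Proof.
apply/codomP=> -[t]; rewrite /oracle_wire /commit_wire.
by case: (split_ordP t) => j _ /eqP; rewrite !eq_shift.
Qed.

Lemma input_commit i j : input_wire i != commit_wire j.
Proof. by rewrite /input_wire /commit_wire eq_shift. Qed.

(** The phase has to come first: it reads the commitment value c, which the XOR by f(x) then erases
    on the consistent part. *)
Definition inverter : seq (gate wires) :=
  czs input_wire commit_wire (enum 'I_n) ++ oracle oracle_wire commit_wire G.

Lemma inverter_ok : circuit_ok inverter.
Proof.
rewrite /inverter /circuit_ok all_cat; apply/andP; split.
  by apply: czs_ok; apply: input_commit.
by apply: oracle_ok => //; [apply: oracle_wire_inj | apply: commit_wire_out].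
Qed.

Lemma size_inverter : (size inverter <= 8 * size G + 13 * n)%N.
Proof.
rewrite size_cat size_czs size_enum_ord.
by have := size_oracle oracle_wire commit_wire G_ok; lia.
Qed.

Definition sgn (y c : bitstr n) : C := \prod_i (-1) ^+ (y i && c i).

Lemma run_inverter (o : bitstr (k + n)) (c y : bitstr n) :
  run inverter (ket C (join (join o c) (join y (zeros (n + af))))) =
  fun a : bitstr wires => sgn y c *
    (a == join (join o [ffun i => c i (+) f (rpart o) i]) (join y (zeros (n + af))))%:R.
Proof.
set e := join _ (join y _).
rewrite run_cat run_czs; last exact: input_commit.
have -> : (fun a : bitstr wires => \prod_(i <- enum 'I_n) (-1) ^+ (a (input_wire i) && a (commit_wire i))
            * ket C e a) = fun a => sgn y c * ket C e a.
  apply: functional_extensionality => a; rewrite /ket; case: eqP => [->|]; last by rewrite !mulr0.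
  congr (_ * _); rewrite big_enum; apply: eq_bigr => i _.
  by rewrite /e join_lshift !join_rshift join_lshift.
rewrite /run app_scale -/(run _ _).
rewrite (run_oracle oracle_wire_inj commit_wire_inj commit_wire_out G_ok
  (e' := join (join o [ffun i => c i (+) f (rpart o) i]) (join y (zeros (n + af))))
  (G_f (rpart o))) //.
- apply/ffunP=> t; rewrite ffunE /oracle_wire /e /io_init.
  by case: (split_ordP t) => j ->; rewrite !(join_lshift, join_rshift) !ffunE.
- by move=> i; rewrite /e /commit_wire !join_lshift !join_rshift ffunE.
move=> j; rewrite /e; case: (split_ordP j) => j1 ->; last by rewrite !join_rshift.
rewrite !join_lshift; case: (split_ordP j1) => j2 -> nj; first by rewrite !join_lshift.
by case/negP: nj; exact: (codom_f commit_wire j2).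
Qed.

Variables (D : op C ((k + n) + n)) (U : op C (k + n)).
Let psi := app D (ket C (zeros ((k + n) + n))).
Let A := alg_op D U [::] inverter [::] false.

(** Up to the factor 2^(n/2), this is the component of U phi along [o] on K and O and |y> in the x
    basis on C; see [overlap_amplitude]. *)
Definition amplitude (y : bitstr n) (o : bitstr (k + n)) : C :=
  \sum_o' U o o' * (sgn y (f (rpart o')) * psi (join o' (f (rpart o')))).

(** After the XOR, register C is zero exactly when it held f of the value in O, and U acts
    elsewhere. This entry therefore sees only the consistent part of [psi]. *)
Lemma alg_amplitude y o :
  A (join (join o (zeros n)) (join y (zeros (n + af)))) (alg_init k (n + af) y) =
  amplitude y o.
Proof.
rewrite /A /alg_op /= mul1op mulop1.
set Dm := embl D; set r := join y _.
pose v : state C wires := fun d => psi (lpart d) * (rpart d == r)%:R.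
have vE : Dm^~ (alg_init k (n + af) y) = v.
  apply: functional_extensionality => d.
  by rewrite /Dm /embl /alg_init join_lpart join_rpart /v /psi app_ket.
rewrite -[LHS]/(app (embl (embl U)) (app (circ_op C inverter) (Dm^~ (alg_init k (n + af) y))) _).
rewrite vE !app_embl /amplitude; apply: eq_bigr => o' _; congr (_ * _).
rewrite /app /v; under eq_bigr do rewrite mulrA.
(* The inverter keeps K and O, so only the term [o1 = o'] survives. *)
rewrite sum_join_delta sum_join (bigD1 o') //= [X in _ + X]big1 ?addr0 => [|o1 ne]; last first.
  apply: big1 => c _; have := run_inverter o1 c y; rewrite /run app_ket => /(congr1 (@^~ _)) ->.
  rewrite eq_bitstrD !join_lpart eq_bitstrD !join_lpart.
  by rewrite [o' == o1]eq_sym (negPf ne) mulr0 mul0r.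
rewrite -(sum_delta (f (rpart o')) (fun c => sgn y c * psi (join o' c))).
apply: eq_bigr => c _; rewrite join_lpart.
have := run_inverter o' c y; rewrite /run app_ket => /(congr1 (@^~ _)) ->.
rewrite !(eq_bitstrD (join _ r)) !join_lpart !join_rpart eqxx andbT.
rewrite (eq_bitstrD (join o' _)) !join_lpart !join_rpart eqxx /=.
have -> : (zeros n == [ffun i => c i (+) f (rpart o') i]) = (c == f (rpart o')).
  apply/eqP/eqP => [/ffunP h|->]; apply/ffunP => i.
    by have := h i; rewrite !ffunE; case: (c i) (f _ i) => [] [].
  by rewrite !ffunE addbb.
by ring.
Qed.

(** Only the outcomes with C zero and the input and ancillas restored are kept; the discarded terms
    are nonnegative. *)
Lemma alg_prob_ge y z :
  \sum_(o | rpart o == z) `|amplitude y o| ^+ 2 <= alg_prob (k:=k) A y z.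
Proof.
rewrite /alg_prob [leRHS]big_mkcond [leLHS]big_mkcond [leRHS]sum_join.
rewrite [leRHS]exchange_big [leRHS](bigD1 (join y (zeros (n + af)))) //= -[leLHS]addr0; apply: lerD; last first.
  by apply: sumr_ge0 => *; apply: sumr_ge0 => *; case: ifP => // _; rewrite exprn_ge0.
rewrite [leRHS]sum_join; apply: ler_sum => o _; rewrite [leRHS](bigD1 (zeros n)) //=.
rewrite !join_lpart alg_amplitude -[leLHS]addr0; apply: lerD => //.
by apply: sumr_ge0 => *; case: ifP => // _; rewrite exprn_ge0.
Qed.

(** The signs left by the inverter are the entries of |z> in the x basis without their normalisation
    2^(-n/2), whose square is the factor on the right. *)
Lemma overlap_amplitude z o :
  `|overlap true z (fun c => app (embl (r:=n) U) (consistent f psi) (join o c))| ^+ 2 =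
  (2 ^+ n)^-1 * `|amplitude z o| ^+ 2.
Proof.
suff -> : overlap true z (fun c => app (embl (r:=n) U) (consistent f psi) (join o c)) =
          ((sqrtC 2)^-1) ^+ n * amplitude z o.
  by rewrite normrM exprMn norm_invsqrt2X.
rewrite /overlap; under eq_bigr do rewrite app_embl /app mulr_sumr.
rewrite exchange_big /= /amplitude mulr_sumr; apply: eq_bigr => o' _.
rewrite -(sum_delta (f (rpart o')) (fun c => _ * (U o o' * (sgn z c * psi (join o' c))))).
apply: eq_bigr => c _; rewrite /consistent join_lpart join_rpart.
have -> : (basis_ket C true z c)^* = ((sqrtC 2)^-1) ^+ n * sgn z c.
  rewrite basis_ket_trueE -/(sgn z c); apply/CrealP; rewrite rpredM ?rpredX //.
    by rewrite rpredV ger0_real // sqrtC_ge0 ler0n.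
  by apply: rpred_prod => i _; rewrite rpredX // rpredN rpred1.
by ring.
Qed.

(** Among all drawn preimages x and accepted outputs z, only the pairs x = z in [W] are kept. They
    contribute X / d, where d counts the preimages of f(W), and d <= 2^n compares this with X /
    2^n. *)
Lemma success_ge (W : {set bitstr n}) :
  norm2 (app (proj_P C (k:=k) f W true) (app (embl (r:=n) U) (consistent f psi)))
    <= alg_success f W A.
Proof.
rewrite norm2_proj; under eq_bigr do rewrite overlap_amplitude.
rewrite -mulr_sumr /alg_success.
set X := \sum_(o | _) _; set d := #|_|.
have X0 : 0 <= X by apply: sumr_ge0 => *; rewrite exprn_ge0.
(* If d = 0, the success value is a division by zero, hence 0, but then [W] is empty and X is 0
   too. *)
have [d0|d0] := posnP d.
  rewrite d0 invr0 mulr0 /X big1 ?mulr0 // => o oW.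
  have := card0_eq d0 (rpart o); by rewrite inE imset_f.
have dn : (d%:R : C) <= 2 ^+ n.
  have cE : #|{: bitstr n}| = (2 ^ n)%N by rewrite card_ffun card_bool card_ord.
  by rewrite -natrX ler_nat -cE max_card.
have d0' : (0 : C) < d%:R by rewrite ltr0n.
apply: (@le_trans _ _ (X / d%:R)).
  by rewrite mulrC ler_wpM2l // lef_pV2 // posrE ?exprn_gt0 ?ltr0n.
apply: ler_wpM2r; first by rewrite invr_ge0 ltW.
rewrite /X (partition_big (@rpart k n) (mem W)) //= [leLHS]big_mkcond [leRHS]big_mkcond.
apply: ler_sum => z _; have [zW|_] := boolP (z \in W); last first.
  case: ifP => // _; apply: sumr_ge0 => z' _; apply: sumr_ge0 => c _; exact: exprn_ge0.
rewrite imset_f // (bigD1 z) /=; last by rewrite zW eqxx.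
rewrite -[leLHS]addr0; apply: lerD; last first.
  by apply: sumr_ge0 => z' _; apply: sumr_ge0 => c _; exact: exprn_ge0.
apply: le_trans (alg_prob_ge _ _); rewrite le_eqVlt; apply/orP; left; apply/eqP.
by apply: eq_big => [o|o /andP[_ /eqP->] //]; case: eqP => [->|]; rewrite ?zW ?andbF.
Qed.

End Inverter.

(** * The reduction with explicit size and success bounds *)

Theorem theorem1 (C : numClosedFieldType) (f : forall n, bitstr n -> bitstr n)
  (s : nat -> C) (s_pos : forall n, 0 < s n) (Hf : qowf f s) :
  exists (c : C) (q : nat -> nat) (N0 : nat),
    0 < c /\ poly_bounded q /\
    forall (n k : nat) (W : {set bitstr n})
      (D : op C ((k + n) + n)) (U : op C (k + n)),
      (N0 <= n)%N -> unitary D -> unitary U ->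
      let psi0 := app D (ket C (zeros ((k + n) + n))) in
      let psi1 := app (embl (r:=n) U) psi0 in
      1 + (sqrtC (s n))^-1 <=
        norm2 (app (proj_P C (k:=k) (f n) W false) psi0) + norm2 (app (proj_P C (k:=k) (f n) W true) psi1) ->
      exists (a : nat) (G1 G2 G3 : seq (gate (((k + n) + n) + (n + a)))) (order : bool),
        circuit_ok (G1 ++ G2 ++ G3) /\
        (size G1 + size G2 + size G3 <= q n)%N /\
        c / s n <= alg_success (f n) W (alg_op D U G1 G2 G3 order).
Proof.
have [[p [[cp [dp p_le]] f_circ]] _] := Hf.
(* The constant is that of [consistent_bound] with [eps ^+ 2 = 1 / s n], the size is that of
   [inverter], and the bounds hold from n = 0 on. *)
exists 6^-1, (fun n => 8 * p n + 13 * n)%N, 0%N; split; first by rewrite invr_gt0 ltr0n.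
split.
  (* Raising the degree absorbs the linear term even when [dp = 0]. The [+ 1] in [nd] covers n = 0
     with [dp = 0], where 0^0 exceeds 0^1; it accounts for half of [16 * cp]. *)
  exists (16 * cp + 13)%N, dp.+1 => n.
  have nd : (n ^ dp <= n ^ dp.+1 + 1)%N.
    case: n => [|n]; first by case: dp {p_le} => [|d] //; rewrite !exp0n.
    by rewrite (leq_trans _ (leq_addr 1 _)) // leq_pexp2l.
  have n1 : (n <= n ^ dp.+1)%N by case: n {nd} => // n; rewrite -{1}[n.+1]expn1 leq_pexp2l.
  have := p_le n; have := leq_mul (leqnn cp) nd.
  by nia.
move=> n k W D U _ uD uU psi0 psi1 le.
have [a [G [G_ok [G_size G_f]]]] := f_circ n.
(* With [order = false], D is applied first; all gates sit between D and U. *)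
exists (n + a)%N, [::], (inverter k G), [::], false; split; first by rewrite cats0 inverter_ok.
split; first by rewrite addn0 (leq_trans (size_inverter k G_ok)) // leq_add2r leq_mul2l G_size.
have psi0_1 : norm2 psi0 = 1 by rewrite norm2_unitary // norm2_ket.
have eps0 : 0 < (sqrtC (s n))^-1 by rewrite invr_gt0 sqrtC_gt0.
apply: le_trans (success_ge G_ok G_f D U W).
apply: le_trans (consistent_bound uU psi0_1 eps0 le).
by rewrite exprVn sqrtCK mulrC.
Qed.
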